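(* Let $H_1, H_2$ be non-empty regular graphs with $H_1 \neq H_2$ and $m_2(H_1) \geq m_2(H_2) > 1$, such that $H_2$ is strictly $2$-balanced, and such that $H_1$ is strictly balanced with respect to $d_2(\cdot,H_2)$ if $m_2(H_1) > m_2(H_2)$ and $H_1$ is strictly $2$-balanced if $m_2(H_1) = m_2(H_2)$. Suppose moreover that none of the following holds: (i) one of $H_1,H_2$ is a complete graph and the other is a cycle; (ii) $H_2$ is a cycle and $|V(H_1)| \geq |V(H_2)|$; (iii) $(H_1,H_2) = (K_3, K_{3,3})$. Then there exists a constant $\varepsilon = \varepsilon(H_1,H_2) > 0$ such that $\hat{\mathcal{A}}(H_1,H_2,\varepsilon)$ is finite and every graph in $\hat{\mathcal{A}}(H_1,H_2,\varepsilon)$ has a valid edge-colouring for $H_1$ and $H_2$.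
   Context: For a graph $H$ write $v_H=|V(H)|$, $e_H=|E(H)|$. Define $d_2(H) = (e_H-1)/(v_H-2)$ if $H$ is non-empty and $v_H \geq 3$; $d_2(K_2)=1/2$; $d_2(H)=0$ otherwise. Let $m_2(H)=\max\{d_2(J) : J \subseteq H\}$. $H$ is strictly $2$-balanced if $d_2(J) < m_2(H)$ for every proper subgraph $J \subsetneq H$. For graphs $H_1,H_2$ define $d_2(H_1,H_2) = e_{H_1}/(v_{H_1} - 2 + 1/m_2(H_2))$ if $H_2$ is non-empty and $v_{H_1} \geq 2$, and $0$ otherwise; $m_2(H_1,H_2) = \max\{d_2(J,H_2) : J \subseteq H_1\}$. $H_1$ is strictly balanced with respect to $d_2(\cdot,H_2)$ if $d_2(J,H_2) < m_2(H_1,H_2)$ for every proper subgraph $J \subsetneq H_1$. For a graph $A$, $d(A)=e_A/v_A$ if $v_A\ge1$ and $0$ otherwise; $m(A)=\max\{d(J): J\subseteq A\}$. A red/blue colouring of the edges of $G$ is a valid edge-colouring for $H_1$ and $H_2$ if it contains no red copy of $H_1$ and no blue copy of $H_2$. For a graph $G$, $\mathcal{R}_G$ is the set of subgraphs of $G$ isomorphic to $H_1$ and $\mathcal{L}_G$ the set of subgraphs isomorphic to $H_2$; $\mathcal{L}^*_G = \{L \in \mathcal{L}_G : \forall e \in E(L)\ \exists R \in \mathcal{R}_G,\ E(L)\cap E(R)=\{e\}\}$. $\mathcal{C}(H_1,H_2)$ is the class of graphs $G$ such that every edge $e$ of $G$ satisfies $E(L)\cap E(R)=\{e\}$ for some $L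 \in \mathcal{L}_G$, $R\in\mathcal{R}_G$; $\mathcal{C}^*(H_1,H_2)$ is the class of graphs $G$ in which every edge lies in some $L \in \mathcal{L}^*_G$. For $m_2(H_1)\ge m_2(H_2)>1$ and $\varepsilon>0$, $\hat{\mathcal{A}}(H_1,H_2,\varepsilon)$ is the class of $2$-connected graphs $A$ with $m(A)\le m_2(H_1,H_2)+\varepsilon$ such that $A\in\mathcal{C}^*(H_1,H_2)$ if $m_2(H_1)>m_2(H_2)$, and $A\in\mathcal{C}(H_1,H_2)$ if $m_2(H_1)=m_2(H_2)$. *)

(* Defs.v *)
From HB Require Import structures.
From mathcomp Require Import all_boot all_order all_algebra.
Set Implicit Arguments. Unset Strict Implicit. Unset Printing Implicit Defensive.
Import Order.TTheory GRing.Theory Num.Theory.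

Record sgraph (T : finType) := SGraph {
  adj : rel T;
  adj_sym : symmetric adj;
  adj_irr : irreflexive adj }.

Section Graphs.
Variable T : finType.
Implicit Type G : sgraph T.

Definition edges G : {set {set T}} :=
  [set [set x; y] | x in [set: T], y in [set: T] & adj G x y].

Definition subgraph G (J : {set T} * {set {set T}}) : bool :=
  (J.2 \subset edges G) && [forall e in J.2, e \subset J.1].

Definition whole G : {set T} * {set {set T}} := (setT, edges G).

Definition nonempty_graph G : bool := 0 < #|edges G|.

Definition deg G (x : T) : nat := #|[set y | adj G x y]|.
Definition regular G : Prop := exists k, forall x, deg G x = k.
Definition complete_graph G : Prop := forall x y, x != y -> adj G x y.
Definition connected G : Prop := forall x y, connect (adj G) x y.
Definition is_cycle G : Prop :=
  3 <= #|T| /\ (forall x, deg G x = 2) /\ connected G.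
Definition two_connected G : Prop :=
  3 <= #|T| /\ connected G /\
  forall v x y, x != v -> y != v ->
    connect [rel a b | adj G a b && (a != v) && (b != v)] x y.
End Graphs.

Definition isomorphic (T T' : finType) (G : sgraph T) (G' : sgraph T') : Prop :=
  exists f : T -> T', bijective f /\ forall x y, adj G' (f x) (f y) = adj G x y.

Definition is_copy (T' T : finType) (H : sgraph T') (G : sgraph T)
    (J : {set T} * {set {set T}}) : Prop :=
  subgraph G J /\
  exists f : T' -> T, injective f /\ J.1 = f @: [set: T'] /\
     J.2 = [set f @: (e : {set T'}) | e in edges H].

Local Open Scope ring_scope.

Definition d2v (v e : nat) : rat :=
  if (0 < e)%N && (3 <= v)%N then (e%:R - 1) / (v%:R - 2)
  else if (v == 2)%N && (e == 1)%N then 1 / 2 else 0.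

Definition m2 (T : finType) (G : sgraph T) : rat :=
  \big[Num.max/0]_(J | subgraph G J) d2v #|J.1| #|J.2|.

Definition strictly_2_balanced (T : finType) (G : sgraph T) : Prop :=
  forall J, subgraph G J -> J != whole G -> d2v #|J.1| #|J.2| < m2 G.

Definition d2pv (T2 : finType) (H2 : sgraph T2) (v e : nat) : rat :=
  if nonempty_graph H2 && (2 <= v)%N then e%:R / (v%:R - 2 + (m2 H2)^-1) else 0.

Definition m2pair (T1 T2 : finType) (H1 : sgraph T1) (H2 : sgraph T2) : rat :=
  \big[Num.max/0]_(J | subgraph H1 J) d2pv H2 #|J.1| #|J.2|.

Definition strictly_balanced_d2 (T1 T2 : finType) (H1 : sgraph T1) (H2 : sgraph T2)
  : Prop :=
  forall J, subgraph H1 J -> J != whole H1 -> d2pv H2 #|J.1| #|J.2| < m2pair H1 H2.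

Definition dv (v e : nat) : rat := if (0 < v)%N then e%:R / v%:R else 0.

Definition mdens (T : finType) (A : sgraph T) : rat :=
  \big[Num.max/0]_(J | subgraph A J) dv #|J.1| #|J.2|.

Definition inC (T1 T2 T : finType) (H1 : sgraph T1) (H2 : sgraph T2) (G : sgraph T)
  : Prop :=
  forall e, e \in edges G -> exists L R,
    is_copy H2 G L /\ is_copy H1 G R /\ L.2 :&: R.2 = [set e].

Definition inLstar (T1 T2 T : finType) (H1 : sgraph T1) (H2 : sgraph T2) (G : sgraph T)
  (L : {set T} * {set {set T}}) : Prop :=
  is_copy H2 G L /\
  forall e, e \in L.2 -> exists R, is_copy H1 G R /\ L.2 :&: R.2 = [set e].

Definition inCstar (T1 T2 T : finType) (H1 : sgraph T1) (H2 : sgraph T2) (G : sgraph T)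
  : Prop :=
  forall e, e \in edges G -> exists L, inLstar H1 H2 G L /\ e \in L.2.

(* the class \hat{A}(H1,H2,eps) (under the standing assumption m2 H1 >= m2 H2 > 1) *)
Definition inAhat (T1 T2 T : finType) (H1 : sgraph T1) (H2 : sgraph T2) (eps : rat)
  (A : sgraph T) : Prop :=
  two_connected A /\ mdens A <= m2pair H1 H2 + eps /\
  (m2 H2 < m2 H1 -> inCstar H1 H2 A) /\
  (m2 H1 = m2 H2 -> inC H1 H2 A).

(* red = true, blue = false; the colour of an edge e is c e *)
Definition valid_colouring (T1 T2 T : finType) (H1 : sgraph T1) (H2 : sgraph T2)
  (G : sgraph T) (c : {set T} -> bool) : Prop :=
  (forall R, is_copy H1 G R -> ~ (forall e, e \in R.2 -> c e)) /\
  (forall L, is_copy H2 G L -> ~ (forall e, e \in L.2 -> ~~ c e)).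

Definition finitely_many_iso (P : forall T : finType, sgraph T -> Prop) : Prop :=
  exists (N : nat) (Gs : 'I_N -> {n : nat & sgraph 'I_n}),
    forall (T : finType) (A : sgraph T), P T A ->
      exists i : 'I_N, isomorphic A (projT2 (Gs i)).

Local Close Scope ring_scope.

Lemma K33_sym : symmetric (fun i j : 'I_6 => (i < 3) != (j < 3)).
Proof. by move=> i j; rewrite eq_sym. Qed.
Lemma K33_irr : irreflexive (fun i j : 'I_6 => (i < 3) != (j < 3)).
Proof. by move=> i; rewrite eqxx. Qed.
Definition K33 : sgraph 'I_6 := SGraph K33_sym K33_irr.

Lemma K3_sym : symmetric (fun i j : 'I_3 => i != j).
Proof. by move=> i j; rewrite eq_sym. Qed.
Lemma K3_irr : irreflexive (fun i j : 'I_3 => i != j).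
Proof. by move=> i; rewrite eqxx. Qed.
Definition K3 : sgraph 'I_3 := SGraph K3_sym K3_irr.

(* Main.v *)
(** Every edge of a graph A in the class is the intersection of a copy of H1 and
    a copy of H2, so if H1 is k1-regular and H2 is k2-regular then every vertex of
    A has degree at least k1 + k2 - 1, whence m(A) >= (k1 + k2 - 1)/2.  Outside the
    exceptional pairs this exceeds m_2(H1,H2): writing v_i = |V(H_i)|, the
    inequality amounts to v1 (k2 v2 - 2) > 2 v2 (k1 + k2 - 1), and the parameters
    for which it fails belong to exceptions of the theorem, isomorphic pairs, or
    pairs with m_2(H1) < m_2(H2).  For epsilon half the gap the class is empty. *)
Require Import Defs.
From HB Require Import structures.
From mathcomp Require Import all_boot all_order all_algebra zify ring lra.
Import Order.TTheory GRing.Theory Num.Theory.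
Local Open Scope ring_scope.
Set Implicit Arguments. Unset Strict Implicit. Unset Printing Implicit Defensive.

(** * Edges, degrees and complete graphs *)

Lemma edgesP (T : finType) (G : sgraph T) (e : {set T}) :
  reflect (exists x y, adj G x y /\ e = [set x; y]) (e \in edges G).
Proof.
apply: (iffP imset2P) => [[x y _]|[x [y [xy ->]]]].
  by rewrite !inE /= => xy ->; exists x, y.
by exists x y; rewrite ?inE.
Qed.

(** The edge set is a parameter because degrees are also counted inside copies and components. *)
Definition incident (T : finType) (E : {set {set T}}) (x : T) : {set {set T}} :=
  [set e in E | x \in e].

Lemma card_incident_edges (T : finType) (G : sgraph T) (x : T) :
  #|incident (edges G) x| = deg G x.
Proof.
have -> : incident (edges G) x = [set [set x; y] | y in [set y | adj G x y]].
  apply/setP => e; rewrite inE; apply/andP/imsetP => [[/edgesP[a [b [ab ->]]]]|].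
    rewrite !inE => /orP[]/eqP ->; first by exists b; rewrite ?inE.
    by exists a; rewrite ?inE 1?setUC // adj_sym.
  move=> [y]; rewrite inE => xy ->; rewrite !inE eqxx; split=> //.
  by apply/edgesP; exists x, y.
rewrite card_in_imset // => y z; rewrite !inE => xy xz /setP/(_ y).
rewrite !inE eqxx orbT => /esym/orP[]/eqP // yx.
by rewrite yx adj_irr in xy.
Qed.

Lemma handshake (T : finType) (G : sgraph T) (E : {set {set T}}) :
  E \subset edges G -> (\sum_x #|incident E x| = #|E| * 2)%N.
Proof.
move=> /subsetP EG; under eq_bigr => x _ do rewrite -sum1_card.
rewrite -sum_nat_const; transitivity (\sum_(e in E) \sum_(x in e) 1)%N.
  rewrite (exchange_big_dep (mem E)) /=; last by move=> x e _; rewrite inE => /andP[].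
  apply: eq_bigr => e eE; apply: eq_bigl => x; by rewrite inE eE.
apply: eq_bigr => e /EG/edgesP[x [y [xy ->]]]; rewrite sum1_card cards2.
by case: eqP xy => // ->; rewrite adj_irr.
Qed.

Lemma sum_deg (T : finType) (G : sgraph T) :
  (\sum_x deg G x = #|edges G| * 2)%N.
Proof.
by rewrite -(handshake (subxx _)); under [RHS]eq_bigr => x _ do rewrite card_incident_edges.
Qed.

Lemma regular_card_edges (T : finType) (G : sgraph T) (k : nat) :
  (forall x, deg G x = k) -> (#|edges G| * 2 = #|T| * k)%N.
Proof. by move=> Gk; rewrite -sum_deg (eq_bigr (fun=> k)) // sum_nat_const. Qed.

Lemma deg_lt_card (T : finType) (G : sgraph T) (x : T) : (deg G x < #|T|)%N.
Proof.
rewrite -cardsT; apply: proper_card; apply/properP; split; first exact: subsetT.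
by exists x; rewrite ?inE // adj_irr.
Qed.

Lemma regular_complete (T : finType) (G : sgraph T) :
  (forall x, (deg G x).+1 = #|T|) -> complete_graph G.
Proof.
move=> Gk x y; apply: contraNT => nxy.
have : (#|x |: [set y | adj G x y]| = #|T|)%N.
  by rewrite cardsU1 inE adj_irr add1n; apply: Gk.
rewrite -cardsT => /(conj (subsetT (x |: [set y | adj G x y])))[sT cT].
have /eqP/setP/(_ y) : x |: [set y | adj G x y] == setT by rewrite eqEcard sT cT /=.
by rewrite !inE (negPf nxy) orbF eq_sym.
Qed.

Lemma complete_isomorphic (T T' : finType) (G : sgraph T) (G' : sgraph T') :
  complete_graph G -> complete_graph G' -> #|T| = #|T'| -> isomorphic G G'.
Proof.
have adjE (S : finType) (K : sgraph S) x y : complete_graph K -> adj K x y = (x != y).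
  by move=> cK; apply/idP/idP => [|/cK //]; apply: contraTneq => ->; rewrite adj_irr.
move=> cG cG' TT'; exists (fun x => enum_val (cast_ord TT' (enum_rank x))); split.
  exists (fun y => enum_val (cast_ord (esym TT') (enum_rank y))) => x;
  by rewrite enum_valK ?cast_ordK ?cast_ordKV enum_rankK.
move=> x y; rewrite !adjE //; congr (~~ _); apply/eqP/eqP => [|-> //].
by move/enum_val_inj/cast_ord_inj/enum_rank_inj.
Qed.

(** * Minimum degree and density of graphs in the class *)

Lemma card_incident_copy (T T' : finType) (H : sgraph T') (G : sgraph T) k J e x :
  (forall t, deg H t = k) -> is_copy H G J -> e \in J.2 -> x \in e ->
  #|incident J.2 x| = k.
Proof.
move=> Hk [_ [f [injf [_ ->]]]] /imsetP[e' _ ->] /imsetP[t _ ->].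
rewrite -(Hk t) -card_incident_edges.
(* The injective [f] carries the edges at [t] bijectively to the edges of the copy at [f t]. *)
have -> : incident [set f @: (e : {set T'}) | e in edges H] (f t) =
    [set f @: (e : {set T'}) | e in incident (edges H) t].
  apply/setP => d; rewrite inE; apply/andP/imsetP.
    by case=> /imsetP[d' d'H ->]; rewrite mem_imset // => td'; exists d'; rewrite ?inE ?d'H.
  by case=> d'; rewrite inE => /andP[d'H td'] ->; rewrite mem_imset // imset_f.
by rewrite card_imset //; apply: imset_inj.
Qed.

(** At [x] the copies [L] and [R] contribute [k2] and [k1] edges and share only the edge
    [[set x; y]], so inclusion-exclusion applies. *)
Lemma inC_deg (T1 T2 T : finType) (H1 : sgraph T1) (H2 : sgraph T2) (A : sgraph T) k1 k2 :
  (forall x, deg H1 x = k1) -> (forall x, deg H2 x = k2) -> inC H1 H2 A ->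
  forall x y, adj A x y -> (k1 + k2 <= (deg A x).+1)%N.
Proof.
move=> Hk1 Hk2 CA x y xy.
have xe : x \in [set x; y] by rewrite !inE eqxx.
have [|L [R [cL [cR LR]]]] := CA [set x; y]; first by apply/edgesP; exists x, y.
have : [set x; y] \in L.2 :&: R.2 by rewrite LR inE.
rewrite inE => /andP[eL eR].
rewrite addnC -(card_incident_copy Hk2 cL eL xe) -(card_incident_copy Hk1 cR eR xe).
rewrite -cardsUI -addn1 leq_add //.
  rewrite -card_incident_edges; apply: subset_leq_card; apply/subsetP => e.
  case: cL cR => [/andP[/subsetP sL _] _] [/andP[/subsetP sR _] _].
  by rewrite !inE => /orP[]/andP[eJ ->]; rewrite andbT; [apply: sL|apply: sR].
rewrite -(cards1 [set x; y]) -LR; apply: subset_leq_card; apply/subsetP => e.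
by rewrite !inE => /andP[/andP[-> _] /andP[-> _]].
Qed.

Lemma inCstar_inC (T1 T2 T : finType) (H1 : sgraph T1) (H2 : sgraph T2) (A : sgraph T) :
  inCstar H1 H2 A -> inC H1 H2 A.
Proof. by move=> CA e /CA[L [[cL LR] /LR[R [cR LRe]]]]; exists L, R. Qed.

Lemma whole_subgraph (T : finType) (G : sgraph T) : subgraph G (whole G).
Proof. by rewrite /subgraph subxx; apply/forall_inP => e _; apply: subsetT. Qed.

(** The whole graph competes in [mdens], and its density is half the average degree. *)
Lemma mdens_ge_min_deg (T : finType) (A : sgraph T) (k : nat) :
  (0 < #|T|)%N -> (forall x, k <= deg A x)%N -> k%:R / 2 <= mdens A.
Proof.
move=> T0 Ak; apply: le_trans (le_bigmax_cond _ _ (whole_subgraph A)).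
rewrite /dv /= cardsT T0 ler_pdivlMr ?ltr0n // mulrAC ler_pdivrMr // -!natrM ler_nat.
by rewrite -sum_deg mulnC -sum_nat_const leq_sum.
Qed.

Lemma two_connected_neighbour (T : finType) (A : sgraph T) (x : T) :
  two_connected A -> exists y, adj A x y.
Proof.
move=> [T3 [cA _]].
have [y yx] : exists y, y != x.
  have: (0 < #|[set~ x]|)%N by rewrite cardsC1; lia.
  by case/card_gt0P => y; rewrite !inE; exists y.
have /connectP[[|z p] /=] := cA x y; first by move=> _ yx'; rewrite yx' eqxx in yx.
by case/andP => xz _ _; exists z.
Qed.

(** * Strictly 2-balanced graphs *)

Lemma d2v_gt1 (v e : nat) : 1 < d2v v e -> (3 <= v)%N /\ d2v v e = (e%:R - 1) / (v%:R - 2).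
Proof.
rewrite /d2v; case: ifP => [/andP[_ ->] //|_].
by case: ifP => _; rewrite ?ltr10 // ltr_pdivlMr ?ltr0n // mul1r ltr_nat.
Qed.

Lemma m2_gt1_card (T : finType) (G : sgraph T) : 1 < m2 G -> (3 <= #|T|)%N.
Proof.
rewrite leqNgt => m1; apply/negP => T3; move: m1; apply/negP; rewrite -leNgt.
apply/bigmax_leP; split=> // J _; rewrite leNgt; apply/negP => /d2v_gt1[].
by move=> /leq_trans/(_ (max_card _)); rewrite leqNgt T3.
Qed.

(** Proper subgraphs lie strictly below the maximum, so the whole graph attains it; a value above 1
    cannot be one of the special values 1/2 and 0 of [d2v]. *)
Lemma strictly_2_balanced_m2 (T : finType) (G : sgraph T) :
  1 < m2 G -> strictly_2_balanced G -> m2 G = (#|edges G|%:R - 1) / (#|T|%:R - 2).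
Proof.
move=> m1 bG.
have mE : m2 G = d2v #|T| #|edges G|.
  apply/eqP; rewrite eq_le; apply/andP; split; last first.
    by rewrite -cardsT; exact: (le_bigmax_cond _ _ (whole_subgraph G)).
  rewrite leNgt; apply/negP => lt; suff: m2 G < m2 G by rewrite ltxx.
  apply/bigmax_ltP; split; first exact: lt_trans m1.
  move=> J sJ; have [->|JG] := eqVneq J (whole G); last exact: bG.
  by rewrite cardsT.
by rewrite mE in m1 *; case: (d2v_gt1 m1).
Qed.

(** A component on c vertices is k-regular, with 2-density (ck/2 - 1)/(c - 2), which decreases in c
    for k >= 2; a proper component would thus be denser than [G]. This serves to recognise a
    2-regular [H2] as a cycle. *)
Lemma strictly_2_balanced_connected (T : finType) (G : sgraph T) (k : nat) :
  1 < m2 G -> strictly_2_balanced G -> (forall x, deg G x = k) -> (2 <= k)%N ->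
  connected G.
Proof.
move=> m1 bG Gk k2 x.
pose C := [set y | connect (adj G) x y].
pose E := [set e in edges G | e \subset C].
suff /setP CT : C = setT by move=> y; have := CT y; rewrite !inE.
apply/eqP; apply: contraT => CT.
have Cadj y z : y \in C -> adj G y z -> z \in C.
  by rewrite !inE => xy yz; apply: connect_trans xy (connect1 yz).
have EG : E \subset edges G by apply/subsetP => e; rewrite inE => /andP[].
have sJ : subgraph G (C, E).
  by rewrite /subgraph EG; apply/forall_inP => e; rewrite inE => /andP[].
(* Edges at a vertex of [C] never leave [C], so such a vertex keeps its full degree; other vertices
   contribute 0. *)
have cardE : (#|E| * 2 = #|C| * k)%N.
  rewrite -(handshake EG) -sum_nat_const [RHS]big_mkcond; apply: eq_bigr => y _.
  case: ifP => yC.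
    rewrite -(Gk y) -card_incident_edges; congr #|pred_of_set _|.
    apply/setP => e; rewrite !inE -andbA; apply: andb_id2l => /edgesP[a [b [ab ->]]].
    have ba : adj G b a by rewrite adj_sym.
    rewrite !inE; apply/andP/idP => [[] //|]; split=> //; apply/subsetP => c.
    by case/orP: H => /eqP yE; rewrite !inE in yC *; case/orP => /eqP ->; subst y => //;
      apply: connect_trans yC (connect1 _).
  apply: eq_card0 => e; rewrite !inE; apply: contraFF yC.
  by case/andP => /andP[_ /subsetP eC] /eC.
have C3 : (2 < #|C|)%N.
  apply: leq_trans (_ : #|x |: [set y | adj G x y]| <= _)%N.
    by rewrite cardsU1 inE adj_irr add1n ltnS -/(deg G x) Gk.
  apply: subset_leq_card; apply/subsetP => y; rewrite !inE => /predU1P[->|xy].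
    exact: connect0.
  exact: connect1.
have CltT : (#|C| < #|T|)%N by rewrite -cardsT proper_card // properT.
have JG : (C, E) != whole G by apply: contra CT => /eqP[->].
have := bG _ sJ JG; rewrite strictly_2_balanced_m2 // /d2v /= C3 andbT.
have -> : (0 < #|E|)%N by nia.
rewrite ltr_pdivrMr ?subr_gt0 ?ltr_nat // mulrAC ltr_pdivlMr ?subr_gt0 ?ltr_nat; last by apply: leq_trans CltT; lia.
have cardG := regular_card_edges Gk.
have : #|E|%:R * 2 = #|C|%:R * k%:R :> rat by rewrite -!natrM cardE.
have : #|edges G|%:R * 2 = #|T|%:R * k%:R :> rat by rewrite -!natrM cardG.
have : #|C|%:R + 1 <= #|T|%:R :> rat by rewrite natr1 ler_nat.
have : 2 <= k%:R :> rat by rewrite ler_nat.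
move: (#|E|%:R : rat) (#|C|%:R : rat) (#|T|%:R : rat) (#|edges G|%:R : rat) (k%:R : rat).
move=> e c n e' q q2 cn e'E eE lt.
(* Once the equal terms e n and e' c cancel, [lt] says 2e' - n < 2e - c, but the difference of these
   sides is (n - c)(q - 1) >= 0. *)
have : 0 <= (n - c) * (q - 1) by apply: mulr_ge0; lra.
have -> : (n - c) * (q - 1) = (e' * 2 - n) - (e * 2 - c) by rewrite e'E eE; ring.
have : (c * q) * n = (n * q) * c by ring.
by rewrite -eE -e'E; nra.
Qed.

(** A triangle has 2-density (3 - 1)/(3 - 2) = 2 and is a proper subgraph when there is a fourth
    vertex, so strict balance would force [m2 G] above 2. *)
Lemma strictly_2_balanced_triangle_free (T : finType) (G : sgraph T) (x y z : T) :
  (3 < #|T|)%N -> m2 G <= 2 -> strictly_2_balanced G ->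
  adj G x y -> adj G y z -> adj G x z = false.
Proof.
move=> T4 m2G bG xy yz; apply/negP => xz.
have neq (a b : T) : adj G a b -> a != b by apply: contraTneq => ->; rewrite adj_irr.
have [nxy nyz nxz] := And3 (neq _ _ xy) (neq _ _ yz) (neq _ _ xz).
pose S := x |: [set y; z].
pose E := [set x; y] |: [set [set y; z]; [set x; z]].
have S3 : #|S| = 3%N by rewrite cardsU1 cards2 !inE negb_or nxy nxz nyz.
have E3 : #|E| = 3%N.
  rewrite cardsU1 cards2 !inE negb_or.
  have -> : [set x; y] != [set y; z].
    by apply/eqP => /setP/(_ x); rewrite !inE eqxx (negPf nxy) (negPf nxz).
  have -> : [set x; y] != [set x; z].
    by apply/eqP => /setP/(_ y); rewrite !inE eqxx orbT eq_sym (negPf nxy) (negPf nyz).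
  have -> // : [set y; z] != [set x; z].
  by apply/eqP => /setP/(_ y); rewrite !inE eqxx (negPf nyz) eq_sym (negPf nxy).
have sJ : subgraph G (S, E).
  apply/andP; split; last first.
    apply/forall_inP => e /=; rewrite !inE => /or3P[]/eqP ->; apply/subsetP => a;
    by rewrite !inE => /orP[]->; rewrite ?orbT.
  apply/subsetP => e /=; rewrite !inE => /or3P[]/eqP ->; apply/edgesP.
  - by exists x, y.
  - by exists y, z.
  - by exists x, z.
have JG : (S, E) != whole G.
  by apply/eqP => -[/(congr1 (fun A : {set T} => #|A|)) + _]; rewrite S3 cardsT; lia.
have := bG _ sJ JG; rewrite /= S3 E3 ltNge (le_trans m2G) //.
Qed.

(** The neighbourhood [S] of a vertex is independent of size 3, so each of its vertices is joined to
    all three vertices of the complement: [S] and [~: S] are the two sides. *)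
Lemma cubic_triangle_free_K33 (T : finType) (G : sgraph T) :
  #|T| = 6%N -> (forall x, deg G x = 3%N) ->
  (forall x y z, adj G x y -> adj G y z -> adj G x z = false) -> isomorphic G K33.
Proof.
move=> T6 G3 tf.
have /card_gt0P[x _] : (0 < #|T|)%N by rewrite T6.
pose N a := [set b | adj G a b].
pose S := N x.
have NE a (B : {set T}) : #|B| = 3%N -> (forall b, adj G a b -> b \in B) -> N a = B.
  move=> B3 aB; apply/eqP; rewrite eqEcard B3 -[X in (_ <= X)%N]/(deg G a) G3 andbT.
  by apply/subsetP => b; rewrite inE => /aB.
have cS : #|S| = 3%N by exact: G3.
have cSC : #|~: S| = 3%N by have := cardsC S; rewrite cS T6; lia.
have NS a : a \in S -> N a = ~: S.
  rewrite inE => xa; apply: NE => // b ab; by rewrite !inE (tf x a b).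
have NSC a : a \notin S -> N a = S.
  move=> aS; apply/eqP; rewrite eq_sym eqEcard cS -[X in (X <= _)%N]/(deg G a) G3 andbT.
  apply/subsetP => b /NS/setP/(_ a); by rewrite !inE adj_sym => ->; rewrite inE in aS.
have adjE a b : adj G a b = ((a \in S) != (b \in S)).
  have -> : adj G a b = (b \in N a) by rewrite inE.
  by have [/NS ->|/NSC ->] := boolP (a \in S); rewrite ?inE //; case: (adj G x b).
(* Listing [S] first makes a position below 3 mean membership in [S], matching the definition of
   [K33]. *)
pose s := enum S ++ enum (~: S).
have sz : size s = 6%N by rewrite size_cat -!cardE cS cSC.
have mem_s a : a \in s by rewrite mem_cat !mem_enum [a \in ~: S]inE orbN.
have lt6 a : (index a s < 6)%N by rewrite -sz index_mem.
have uniq_s : uniq s.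
  rewrite cat_uniq !enum_uniq andbT; apply/hasPn => a /=.
  by rewrite !mem_enum [a \in ~: S]inE.
exists (fun a => Ordinal (lt6 a)); split.
  exists (fun i : 'I_6 => nth x s i) => [a|i] /=; first by rewrite nth_index.
  by apply: val_inj; rewrite /= index_uniq // sz.
have indexE a : (index a s < 3)%N = (a \in S).
  rewrite index_cat mem_enum; case: ifP => aS.
    by rewrite -cS cardE index_mem mem_enum.
  by rewrite -cardE cS ltnNge leq_addr.
by move=> a b; rewrite /= !indexE adjE.
Qed.

(** * Bounding m_2(H1,H2) by the value at the whole of H1 *)

Lemma m2pair_le (T1 T2 : finType) (H1 : sgraph T1) (H2 : sgraph T2) :
  (2 <= #|T1|)%N -> 0 < m2 H2 ->
  strictly_balanced_d2 H1 H2 ->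
  m2pair H1 H2 <= #|edges H1|%:R / (#|T1|%:R - 2 + (m2 H2)^-1).
Proof.
move=> T1_2 m0 bH1.
have pos : 0 <= #|edges H1|%:R / (#|T1|%:R - 2 + (m2 H2)^-1).
  by rewrite divr_ge0 // addr_ge0 ?invr_ge0 ?(ltW m0) // subr_ge0 ler_nat.
rewrite leNgt; apply/negP => lt; suff: m2pair H1 H2 < m2pair H1 H2 by rewrite ltxx.
apply/bigmax_ltP; split; first exact: le_lt_trans lt.
move=> J sJ; have [->|JG] := eqVneq J (whole H1); last exact: bH1.
by rewrite /d2pv /= cardsT T1_2 andbT; case: ifP => // _; apply: le_lt_trans lt.
Qed.

(** With m the common 2-density, the right side is m itself, and e/(v - 2 + 1/m) <= m is equivalent
    to e - 1 <= m(v - 2). *)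
Lemma m2pair_le_eq (T1 T2 : finType) (H1 : sgraph T1) (H2 : sgraph T2) :
  1 < m2 H1 -> m2 H1 = m2 H2 -> strictly_2_balanced H1 ->
  m2pair H1 H2 <= #|edges H1|%:R / (#|T1|%:R - 2 + (m2 H2)^-1).
Proof.
move=> m1 mE bH1; have m0 : 0 < m2 H1 by apply: lt_trans m1.
have T3 := m2_gt1_card m1.
have -> : #|edges H1|%:R / (#|T1|%:R - 2 + (m2 H2)^-1) = m2 H1.
  have d0 : 0 < #|T1|%:R - 2 :> rat by rewrite subr_gt0 ltr_nat.
  rewrite -mE; apply: (canLR (mulfK _)).
    by rewrite gt_eqF // addr_gt0 ?invr_gt0.
  rewrite mulrDr mulfV ?gt_eqF //.
  by rewrite {1}strictly_2_balanced_m2 // divfK ?gt_eqF // subrK.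
apply/bigmax_leP; split=> [|J sJ]; first exact: ltW.
rewrite /d2pv -mE; case: ifP => [/andP[_ J2]|_]; last exact: ltW.
have den : 0 < #|J.1|%:R - 2 + (m2 H1)^-1.
  by rewrite ltr_wpDl ?invr_gt0 // subr_ge0 ler_nat.
rewrite ler_pdivrMr // mulrDr mulfV ?gt_eqF // -lerBlDr.
have [J3|] := leqP 3 #|J.1|.
  rewrite -ler_pdivrMr ?subr_gt0 ?ltr_nat //.
  (* An edgeless [J] gives a negative quotient here, not the default 0 of [d2v]. *)
  have [e0|] := posnP #|J.2|.
    rewrite e0 sub0r mulNr; apply: le_trans (ltW m0); rewrite oppr_le0 divr_ge0 //.
    by rewrite subr_ge0 ler_nat.
  move=> e0; have -> : (#|J.2|%:R - 1) / (#|J.1|%:R - 2) = d2v #|J.1| #|J.2|.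
    by rewrite /d2v e0 J3.
  exact: (le_bigmax_cond _ _ sJ).
(* On two vertices the claim reduces to [J] having at most one edge. *)
rewrite ltnS => J2'; have {J2 J2'}J2 : #|J.1| = 2%N by apply/eqP; rewrite eqn_leq J2' J2.
rewrite J2 subrr mulr0 subr_le0 -[1]/(1%:R) ler_nat -(cards1 J.1).
case/andP: sJ => /subsetP JG /forall_inP J21; apply: subset_leq_card.
apply/subsetP => e eJ; rewrite inE eqEcard J21 // J2.
case/JG/edgesP: eJ => x [y [xy ->]]; rewrite cards2.
by case: eqP xy => // ->; rewrite adj_irr.
Qed.

(** At most 3 edges give (3 - 1)/(3 - 2) = 2; through [m2 H2 <= m2 H1] this restricts [H2] when [H1]
    has three vertices. *)
Lemma m2_card3 (T : finType) (G : sgraph T) : #|T| = 3%N -> m2 G <= 2.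
Proof.
move=> T3; apply/bigmax_leP; split=> // J /andP[/subset_leq_card JG _].
have e3 : (#|J.2| <= 3)%N.
  rewrite (leq_trans JG) // -(leq_pmul2r (isT : 0 < 2)%N) -sum_deg.
  rewrite (_ : 3 * 2 = #|T| * 2)%N ?T3 // -T3 -sum_nat_const leq_sum // => x _.
  by rewrite -ltnS -T3 deg_lt_card.
have := max_card (mem J.1); rewrite T3 /d2v leq_eqVlt => /predU1P[->|].
  case: ifP => _ //=; rewrite ler_pdivrMr ?subr_gt0 ?ltr_nat //.
  have : #|J.2|%:R <= 3 :> rat by rewrite ler_nat.
  lra.
by rewrite ltnS [(3 <= _)%N]ltnNge => -> ; rewrite andbF; case: ifP.
Qed.

(** * Arithmetic of the parameters *)

Lemma regular_density_gap (v1 k1 e1 v2 k2 e2 : nat) :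
  (e1 * 2 = v1 * k1)%N -> (e2 * 2 = v2 * k2)%N -> (2 < v1)%N -> (2 < v2)%N ->
  (1 < k2)%N ->
  (2 * v2 * (k1 + k2) + 2 * v1 < v1 * (k2 * v2) + 2 * v2)%N ->
  e1%:R / (v1%:R - 2 + ((e2%:R - 1) / (v2%:R - 2))^-1) < (k1%:R + k2%:R - 1) / 2 :> rat.
Proof.
move=> E1 E2 V1 V2 K2 key.
have {}E1 : e1%:R = v1%:R * k1%:R / 2 :> rat by rewrite -natrM -E1 natrM mulfK.
have {}E2 : e2%:R = v2%:R * k2%:R / 2 :> rat by rewrite -natrM -E2 natrM mulfK.
rewrite {}E1 {}E2; move: V1 V2 K2 key.
rewrite -!(ltr_nat rat) !natrD !natrM natrD.
move: (v1%:R : rat) (v2%:R : rat) (k1%:R : rat) (k2%:R : rat) => {v1 v2 k1 k2 e1 e2} v1 v2 k1 k2.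
move=> V1 V2 K2 key.
have q0 : 0 < k2 * v2 - 2 by nra.
have -> : ((v2 * k2 / 2 - 1) / (v2 - 2))^-1 = 2 * (v2 - 2) / (k2 * v2 - 2).
  field; rewrite !gt_eqF //; lra.
have D0 : 0 < v1 - 2 + 2 * (v2 - 2) / (k2 * v2 - 2).
  by apply: addr_gt0; [lra|apply: divr_gt0 => //; lra].
rewrite ltr_pdivrMr // -(ltr_pM2r q0).
have -> : (k1 + k2 - 1) / 2 * (v1 - 2 + 2 * (v2 - 2) / (k2 * v2 - 2)) * (k2 * v2 - 2) =
  (k1 + k2 - 1) / 2 * ((v1 - 2) * (k2 * v2 - 2) + 2 * (v2 - 2)).
  by field; rewrite gt_eqF.
(* After clearing denominators, this product is exactly twice the difference of the two sides; [key]
   makes its second factor positive. *)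
have : 0 < (k2 - 1) * (v1 * (k2 * v2 - 2) - 2 * v2 * (k1 + k2 - 1)).
  by apply: mulr_gt0; lra.
nra.
Qed.

(** For [k2 = 2] the graph [H2] will be a cycle. The three excluded triples, where the inequality
    fails, are the parameters of (K3, K4), (K4, K4) and K3 with a cubic graph on six vertices. *)
Lemma regular_pair_inequality (v1 k1 v2 k2 : nat) :
  (2 < v1)%N -> (k2 < v2)%N -> (k1 < v1)%N -> (1 < k2)%N ->
  ~~ odd (v2 * k2) ->
  (k2 = 2 -> (k1.+1 < v1)%N && (v1 < v2)%N)%N ->
  (k1.+1 = v1 -> ~ (v1 = 3 /\ k2 = 3 /\ v2 = 4))%N ->
  (k1.+1 = v1 -> ~ (v1 = 4 /\ k2 = 3 /\ v2 = 4))%N ->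
  (k1.+1 = v1 -> ~ (v1 = 3 /\ k2 = 3 /\ v2 = 6))%N ->
  (2 * v2 * (k1 + k2) + 2 * v1 < v1 * (k2 * v2) + 2 * v2)%N.
Proof.
move=> V1 V2 K1 K2 par c2 e1 e2 e3.
have [k22|k23] := eqVneq k2 2%N; first by have/andP[] := c2 k22; subst k2; nia.
have {K2 k23 c2} k23 : (2 < k2)%N by lia.
have [k1v1|k1v1] := eqVneq k1.+1 v1; last first.
  have : (k1.+2 <= v1)%N by lia.
  clear e1 e2 e3 par; move: K1 => _ k1v.
  (* Only the left side depends on [k1], so [k1 = v1 - 2] is the worst case. *)
  have : (2 * v2 * (k1 + k2) <= 2 * v2 * (v1 - 2 + k2))%N by rewrite leq_mul2l; lia.
  nia.
have := e1 k1v1; have := e2 k1v1; have := e3 k1v1 => {}e3 {}e2 {}e1; subst v1.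
have [k4|k4] := leqP 4 k2.
  (* Shifting by the lower bounds leaves a polynomial with nonnegative coefficients and positive
     constant term. *)
  have [w ->] : exists w, k1 = (w + 2)%N by exists (k1 - 2)%N; lia.
  have [q ->] : exists q, k2 = (q + 4)%N by exists (k2 - 4)%N; lia.
  have [u ->] : exists u, v2 = (u + 5)%N by exists (v2 - 5)%N; lia.
  clear; nia.
(* Now the claim reads (v1 - 2)(v2 - 2) > 4; among the small [v2], parity removes 5 and 7. *)
have k3 : k2 = 3%N by lia.
subst k2; have [v8|v8] := leqP 8 v2; first by clear e1 e2 e3 par; nia.
have : v2 \in [:: 4; 5; 6; 7]%N by rewrite !inE; lia.
by rewrite !inE; case/or4P => /eqP ?; subst v2 => //; lia.
Qed.

(** * Excluding the exceptional parameters *)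

Lemma regular_pair_density_gap (T1 T2 : finType) (H1 : sgraph T1) (H2 : sgraph T2)
    (k1 k2 : nat) :
  (forall x, deg H1 x = k1) -> (forall x, deg H2 x = k2) ->
  ~ isomorphic H1 H2 ->
  m2 H2 <= m2 H1 -> 1 < m2 H2 ->
  strictly_2_balanced H2 ->
  (m2 H2 < m2 H1 -> strictly_balanced_d2 H1 H2) ->
  (m2 H1 = m2 H2 -> strictly_2_balanced H1) ->
  ~ (complete_graph H1 /\ is_cycle H2) ->
  ~ (is_cycle H2 /\ (#|T2| <= #|T1|)%N) ->
  ~ (isomorphic H1 K3 /\ isomorphic H2 K33) ->
  m2pair H1 H2 < (k1%:R + k2%:R - 1) / 2.
Proof.
move=> Hk1 Hk2 niso m21 m2_gt1 bH2 bH1lt bH1eq ncc ncyc nK33.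
have m1_gt1 := lt_le_trans m2_gt1 m21.
have V1 := m2_gt1_card m1_gt1; have V2 := m2_gt1_card m2_gt1.
have /card_gt0P[x1 _] : (0 < #|T1|)%N by apply: leq_trans V1.
have /card_gt0P[x2 _] : (0 < #|T2|)%N by apply: leq_trans V2.
have K1 : (k1 < #|T1|)%N by rewrite -(Hk1 x1) deg_lt_card.
have K2 : (k2 < #|T2|)%N by rewrite -(Hk2 x2) deg_lt_card.
have E1 := regular_card_edges Hk1; have E2 := regular_card_edges Hk2.
have m2E := strictly_2_balanced_m2 m2_gt1 bH2.
(* [m2 H2 > 1] gives at least as many edges as vertices, hence average degree at least 2. *)
have k2_gt1 : (1 < k2)%N.
  have: (#|T2| < #|edges H2|.+1)%N.
    move: m2_gt1; rewrite m2E ltr_pdivlMr ?subr_gt0 ?ltr_nat // mul1r => lt.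
    by rewrite -(ltr_nat rat) -natr1; lra.
  move=> lt; rewrite ltnNge; apply/negP => k2_le1.
  have : (#|edges H2| * 2 <= #|T2| * 1)%N by rewrite E2 leq_mul2l k2_le1 orbT.
  by move: V2 lt; lia.
have cG1 : (k1.+1 = #|T1|)%N -> complete_graph H1.
  by move=> kT; apply: regular_complete => x; rewrite Hk1.
have cG2 : (k2.+1 = #|T2|)%N -> complete_graph H2.
  by move=> kT; apply: regular_complete => x; rewrite Hk2.
have m2pair_bound : m2pair H1 H2 <= #|edges H1|%:R / (#|T1|%:R - 2 + (m2 H2)^-1).
  move: m21; rewrite le_eqVlt => /orP[/eqP m12|m12].
    by apply: m2pair_le_eq => //; apply: bH1eq.
  by apply: m2pair_le; [exact: ltnW|exact: lt_trans m2_gt1|exact: bH1lt].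
apply: le_lt_trans m2pair_bound _; rewrite m2E.
apply: regular_density_gap => //; apply: regular_pair_inequality => //.
- by rewrite -E2 oddM andbF.
- move=> k22; have cyc : is_cycle H2.
    split=> //; split=> [x|]; first by rewrite Hk2.
    exact: strictly_2_balanced_connected Hk2 k2_gt1.
  apply/andP; split; last by rewrite ltnNge; apply/negP => ?; apply: ncyc.
  rewrite ltn_neqAle K1 andbT; apply/eqP => kT; apply: ncc; split=> //; exact: cG1.
(* Here [m2 H2] = (6 - 1)/(4 - 2) = 5/2, above the bound 2 for [m2 H1]. *)
- move=> _ [T1_3 [k23 T2_4]]; have := le_trans m21 (m2_card3 H1 T1_3).
  have e6 : #|edges H2| = 6%N by apply/eqP; rewrite -(eqn_pmul2r (isT : 0 < 2)%N) E2 k23 T2_4.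
  by rewrite m2E e6 T2_4.
(* Both graphs are K4. *)
- move=> kT [T1_4 [k23 T2_4]]; apply: niso.
  by apply: complete_isomorphic; rewrite ?T1_4 ?T2_4 //; [exact: cG1|apply: cG2; rewrite k23].
(* [m2 H2 <= m2 H1 <= 2] makes the cubic graph [H2] triangle-free, hence isomorphic to [K33]. *)
move=> kT [T1_3 [k23 T2_6]]; apply: nK33; split.
  by apply: complete_isomorphic; rewrite ?card_ord //; exact: cG1.
apply: cubic_triangle_free_K33 => // [x|x y z]; first by rewrite Hk2.
apply: strictly_2_balanced_triangle_free => //; first by rewrite T2_6.
exact: le_trans m21 (m2_card3 H1 T1_3).
Qed.

Theorem theorem1p4 (T1 T2 : finType) (H1 : sgraph T1) (H2 : sgraph T2) :
  nonempty_graph H1 -> nonempty_graph H2 ->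
  regular H1 -> regular H2 ->
  ~ isomorphic H1 H2 ->
  m2 H2 <= m2 H1 -> 1 < m2 H2 ->
  strictly_2_balanced H2 ->
  (m2 H2 < m2 H1 -> strictly_balanced_d2 H1 H2) ->
  (m2 H1 = m2 H2 -> strictly_2_balanced H1) ->
  ~ ((complete_graph H1 /\ is_cycle H2) \/ (is_cycle H1 /\ complete_graph H2)) ->
  ~ (is_cycle H2 /\ (#|T2| <= #|T1|)%N) ->
  ~ (isomorphic H1 K3 /\ isomorphic H2 K33) ->
  exists eps : rat, 0 < eps /\
    finitely_many_iso (fun T A => inAhat H1 H2 eps A) /\
    forall (T : finType) (A : sgraph T), inAhat H1 H2 eps A ->
      exists c : {set T} -> bool, valid_colouring H1 H2 A c.
Proof.
move=> _ _ [k1 Hk1] [k2 Hk2] niso m21 m2_gt1 bH2 bH1lt bH1eq nKC ncyc nK33.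
have gap : m2pair H1 H2 < (k1%:R + k2%:R - 1) / 2.
  by apply: (regular_pair_density_gap Hk1 Hk2) => // cc; apply: nKC; left.
pose eps := ((k1%:R + k2%:R - 1) / 2 - m2pair H1 H2) / 2.
have eps_gt0 : 0 < eps by rewrite /eps; lra.
suff empty (T : finType) (A : sgraph T) : ~ inAhat H1 H2 eps A.
  exists eps; split=> //; split=> [|T A /empty //].
  (* The list of representatives is empty; [K3] is a dummy value on ['I_0]. *)
  by exists 0%N, (fun=> existT (fun n => sgraph 'I_n) 3%N K3) => T A /empty.
move=> [cA [dA [Cstar CA]]].
have {Cstar}CA : inC H1 H2 A.
  move: m21; rewrite le_eqVlt => /orP[/eqP m12|/Cstar/inCstar_inC //].
  exact: CA.
have degA x : ((k1 + k2).-1 <= deg A x)%N.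
  have [y xy] := two_connected_neighbour x cA.
  by have := inC_deg Hk1 Hk2 CA xy; lia.
have T0 : (0 < #|T|)%N by apply: leq_trans (proj1 cA).
have := mdens_ge_min_deg T0 degA.
(* The natural-number predecessor truncates at 0, so an inequality is stated. *)
have : k1%:R + k2%:R - 1 <= (k1 + k2).-1%:R :> rat.
  by rewrite lerBlDr natr1 -natrD ler_nat leqSpred.
move: dA; rewrite /eps; lra.
Qed.
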